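(* Let $F_1:X_1\to H_1$ and $F_2:X_2\to H_2$ be mappings. The mapping $\mathcal{F}=F_1\otimes F_2:X\to H_1\otimes H_2$ is a continuous frame associated to $(a_2\otimes b_2,\dots,a_n\otimes b_n)$ for $H_1\otimes H_2$ with respect to $(X,\mu)$ if and only if $F_1$ is a continuous frame associated to $(a_2,\dots,a_n)$ for $H_1$ with respect to $(X_1,\mu_1)$ and $F_2$ is a continuous frame associated to $(b_2,\dots,b_n)$ for $H_2$ with respect to $(X_2,\mu_2)$.
   Context: Let $n\ge 2$. An $n$-inner product on a complex vector space $H$ with $\dim H\ge n$ is a map $(x,y,x_2,\dots,x_n)\mapsto\langle x,y\mid x_2,\dots,x_n\rangle\in\mathbb{C}$ such that: (i) $\langle x_1,x_1\mid x_2,\dots,x_n\rangle\ge 0$, with equality iff $x_1,\dots,x_n$ are linearly dependent; (ii) it is invariant under permutations of $x_2,\dots,x_n$; (iii) $\langle x,y\mid x_2,\dots,x_n\rangle=\overline{\langle y,x\mid x_2,\dots,x_n\rangle}$; (iv), (v) it is linear in $x$. The induced $n$-norm is $\|x_1,x_2,\dots,x_n\|=\langle x_1,x_1\mid x_2,\dots,x_n\rangle^{1/2}$. $H$ is an $n$-Hilbert space if it is complete: every sequence $(x_k)$ with $\|x_l-x_k,e_2,\dots,e_n\|\to0$ for all $e_2,\dots,e_n\in H$ has some $x\in H$ with $\|x_k-x,e_2,\dots,e_n\|\to 0$ for all $e_2,\dots,e_n\in H$. $H_1,H_2$ are complex $n$-Hilbert spaces with $n$-inner products $\langle\cdot,\cdot\mid\cdot,\dots,\cdot\rangle_1$,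 $\langle\cdot,\cdot\mid\cdot,\dots,\cdot\rangle_2$ and induced $n$-norms $\|\cdot,\dots,\cdot\|_1$, $\|\cdot,\dots,\cdot\|_2$; $a_2,\dots,a_n\in H_1$ are linearly independent, and $b_2,\dots,b_n\in H_2$ are linearly independent. On elementary tensors of $H_1\otimes H_2$ one sets $$\langle f\otimes g,f_1\otimes g_1\mid f_2\otimes g_2,\dots,f_n\otimes g_n\rangle=\langle f,f_1\mid f_2,\dots,f_n\rangle_1\,\langle g,g_1\mid g_2,\dots,g_n\rangle_2,$$ $$\|f_1\otimes g_1,\dots,f_n\otimes g_n\|=\|f_1,\dots,f_n\|_1\,\|g_1,\dots,g_n\|_2.$$ $(X,\mu)=(X_1\times X_2,\mu_1\otimes\mu_2)$ is the product of measure spaces with $\sigma$-finite positive measures $\mu_1,\mu_2$, and $(F_1\otimes F_2)(x_1,x_2)=F_1(x_1)\otimes F_2(x_2)$. $F_1:X_1\to H_1$ is a continuous frame associated to $(a_2,\dots,a_n)$ for $H_1$ with respect to $(X_1,\mu_1)$ if for every $f\in H_1$ the function $x_1\mapsto\langle f,F_1(x_1)\mid a_2,\dots,a_n\rangle_1$ is measurable and there are $0<A\le B<\infty$ with $A\|f,a_2,\dots,a_n\|_1^2\le\int_{X_1}|\langle f,F_1(x_1)\mid a_2,\dots,a_n\rangle_1|^2d\mu_1(x_1)\le B\|f,a_2,\dots,a_n\|_1^2$ for all $f\in H_1$; similarly for $F_2$ with $(b_2,\dots,b_n)$, $H_2$, $(X_2,\mu_2)$. $\mathcal{F}=F_1\otimes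 F_2$ is a continuous frame associated to $(a_2\otimes b_2,\dots,a_n\otimes b_n)$ for $H_1\otimes H_2$ with respect to $(X,\mu)$ if for all $f\in H_1$, $g\in H_2$ the function $x\mapsto\langle f\otimes g,\mathcal{F}(x)\mid a_2\otimes b_2,\dots,a_n\otimes b_n\rangle$ is measurable on $X$, and there are constants $A,B>0$ with $$A\|f\otimes g,a_2\otimes b_2,\dots,a_n\otimes b_n\|^2\le\int_X|\langle f\otimes g,\mathcal{F}(x)\mid a_2\otimes b_2,\dots,a_n\otimes b_n\rangle|^2d\mu(x)\le B\|f\otimes g,a_2\otimes b_2,\dots,a_n\otimes b_n\|^2$$ for all $f\in H_1$, $g\in H_2$. *)

(* Defs.v *)
From HB Require Import structures.
From mathcomp Require Import all_boot all_order all_algebra complex.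
From mathcomp Require Import all_classical all_reals all_analysis.
Set Implicit Arguments.
Unset Strict Implicit.
Unset Printing Implicit Defensive.
Import Order.TTheory GRing.Theory Num.Theory.
Import numFieldNormedType.Exports.
Local Open Scope classical_set_scope.
Local Open Scope complex_scope.
Local Open Scope ring_scope.

(* [free] of vector.v is restricted to finite-dimensional spaces. *)
Definition lin_indep (K : fieldType) (V : lmodType K) (s : seq V) : Prop :=
  forall c : 'I_(size s) -> K,
    \sum_(i < size s) c i *: s`_i = 0 -> forall i, c i = 0.

(* <x, y | x_2, ..., x_n> is written [ip x y v] with v = [tuple x_2; ...; x_n]
   of length n - 1. *)
Record n_inner_product (R : realType) (n : nat) (H : lmodType R[i])
    (ip : H -> H -> n.-1.-tuple H -> R[i]) : Prop := {
  nip_ge0 : forall (x : H) (v : n.-1.-tuple H), 0 <= ip x x v;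
  nip_eq0 : forall (x : H) (v : n.-1.-tuple H),
    ip x x v = 0 <-> ~ lin_indep (x :: v);
  nip_perm : forall (x y : H) (v w : n.-1.-tuple H),
    perm_eq v w -> ip x y v = ip x y w;
  nip_conj : forall (x y : H) (v : n.-1.-tuple H), ip x y v = (ip y x v)^*;
  nip_add : forall (x x' y : H) (v : n.-1.-tuple H),
    ip (x + x') y v = ip x y v + ip x' y v;
  nip_scale : forall (c : R[i]) (x y : H) (v : n.-1.-tuple H),
    ip (c *: x) y v = c * ip x y v }.

(* ||x, x_2, ..., x_n||; the real part loses nothing, as <x, x | v> is a
   nonnegative real by [nip_ge0]. *)
Definition n_norm (R : realType) (n : nat) (H : lmodType R[i])
    (ip : H -> H -> n.-1.-tuple H -> R[i]) (x : H) (v : n.-1.-tuple H) : R :=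
  Num.sqrt (complex.Re (ip x x v)).

Definition n_complete (R : realType) (n : nat) (H : lmodType R[i])
    (ip : H -> H -> n.-1.-tuple H -> R[i]) : Prop :=
  forall u : nat -> H,
    (forall e : n.-1.-tuple H,
       (fun p : nat * nat => n_norm ip (u p.1 - u p.2) e)
         @ filter_prod \oo \oo --> (0 : R)) ->
    exists x : H, forall e : n.-1.-tuple H,
      (fun k => n_norm ip (u k - x) e) @ \oo --> (0 : R).

Record n_hilbert (R : realType) (n : nat) (H : lmodType R[i])
    (ip : H -> H -> n.-1.-tuple H -> R[i]) : Prop := {
  nh_dim : exists s : n.-tuple H, lin_indep s;
  nh_ip : n_inner_product ip;
  nh_complete : n_complete ip }.

(* Borel measurability; the topology of C is that of the modulus, which comes
   with the [numFieldType] structure of R[i]. *)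
Definition cmeasurable (R : realType) (d : measure_display)
    (X : measurableType d) (h : X -> R[i]) : Prop :=
  measurable_fun [set: X] (h : X ->
    g_sigma_algebraType (@open (R[i] : numFieldType))).

Definition continuous_frame (R : realType) (n : nat) (H : lmodType R[i])
    (ip : H -> H -> n.-1.-tuple H -> R[i]) (a : n.-1.-tuple H)
    (d : measure_display) (X : measurableType d)
    (mu : {sigma_finite_measure set X -> \bar R}) (F : X -> H) : Prop :=
  (forall f : H, cmeasurable (fun x => ip f (F x) a)) /\
  exists A B : R, [/\ 0 < A, A <= B &
    forall f : H,
      ((A * n_norm ip f a ^+ 2)%:E
         <= \int[mu]_x (Normc.normc (ip f (F x) a) ^+ 2)%:E)%E /\
      (\int[mu]_x (Normc.normc (ip f (F x) a) ^+ 2)%:E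
         <= (B * n_norm ip f a ^+ 2)%:E)%E].

Definition bilinear_map (K : fieldType) (U V W : lmodType K)
    (b : U -> V -> W) : Prop :=
  (forall (c : K) (x x' : U) (y : V),
     b (c *: x + x') y = c *: b x y + b x' y) /\
  (forall (c : K) (x : U) (y y' : V),
     b x (c *: y + y') = c *: b x y + b x y').

(* [otimes] exhibits T as the algebraic tensor product of U and V. *)
Definition tensor_product (K : fieldType) (U V T : lmodType K)
    (otimes : U -> V -> T) : Prop :=
  bilinear_map otimes /\
  forall (W : lmodType K) (b : U -> V -> W), bilinear_map b ->
    exists! l : {linear T -> W}, forall x y, l (otimes x y) = b x y.

Definition otimes_tuple (U V T : Type) (otimes : U -> V -> T) (m : nat)
    (a : m.-tuple U) (b : m.-tuple V) : m.-tuple T :=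
  [tuple otimes (tnth a i) (tnth b i) | i < m].

(* The values of the form and of the n-norm of the tensor product on elementary
   tensors, for the family a_2 (x) b_2, ..., a_n (x) b_n in the last n - 1
   slots.  Only this family is constrained: the axioms of [n_inner_product] do
   not say how <x, y | x_2, ..., x_n> changes when x_2, ..., x_n are rescaled,
   so the product formula need not be independent of the chosen factors
   of an elementary tensor when it is imposed for all families at once.
   For fixed a and b it always is. *)
Definition tensor_ip (R : realType) (n : nat) (H1 H2 T : lmodType R[i])
    (otimes : H1 -> H2 -> T)
    (ip1 : H1 -> H1 -> n.-1.-tuple H1 -> R[i])
    (ip2 : H2 -> H2 -> n.-1.-tuple H2 -> R[i])
    (ipT : T -> T -> n.-1.-tuple T -> R[i])
    (a : n.-1.-tuple H1) (b : n.-1.-tuple H2) : Prop :=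
  forall (f f1 : H1) (g g1 : H2),
    ipT (otimes f g) (otimes f1 g1) (otimes_tuple otimes a b) =
    ip1 f f1 a * ip2 g g1 b.

Definition tensor_norm (R : realType) (n : nat) (H1 H2 T : lmodType R[i])
    (otimes : H1 -> H2 -> T)
    (ip1 : H1 -> H1 -> n.-1.-tuple H1 -> R[i])
    (ip2 : H2 -> H2 -> n.-1.-tuple H2 -> R[i])
    (normT : T -> n.-1.-tuple T -> R)
    (a : n.-1.-tuple H1) (b : n.-1.-tuple H2) : Prop :=
  forall (f : H1) (g : H2),
    normT (otimes f g) (otimes_tuple otimes a b) =
    n_norm ip1 f a * n_norm ip2 g b.

(* Both conditions range over elementary tensors f (x) g only. *)
Definition tensor_continuous_frame (R : realType) (n : nat)
    (H1 H2 T : lmodType R[i]) (otimes : H1 -> H2 -> T)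
    (ipT : T -> T -> n.-1.-tuple T -> R[i])
    (normT : T -> n.-1.-tuple T -> R) (w : n.-1.-tuple T)
    (d : measure_display) (X : measurableType d)
    (mu : set X -> \bar R) (F : X -> T) : Prop :=
  (forall (f : H1) (g : H2),
     cmeasurable (fun x => ipT (otimes f g) (F x) w)) /\
  exists A B : R, [/\ 0 < A, 0 < B &
    forall (f : H1) (g : H2),
      ((A * normT (otimes f g) w ^+ 2)%:E
         <= \int[mu]_x (Normc.normc (ipT (otimes f g) (F x) w) ^+ 2)%:E)%E /\
      (\int[mu]_x (Normc.normc (ipT (otimes f g) (F x) w) ^+ 2)%:E
         <= (B * normT (otimes f g) w ^+ 2)%:E)%E].

(* Main.v *)
Require Import Defs.
From mathcomp Require Import all_boot all_order all_algebra complex.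
From mathcomp Require Import all_classical all_reals all_analysis.
From mathcomp Require Import measurable_realfun lra.
Import Order.TTheory GRing.Theory Num.Theory.
Import numFieldNormedType.Exports.
Local Open Scope classical_set_scope.
Local Open Scope complex_scope.
Local Open Scope ring_scope.
Set Implicit Arguments.
Unset Strict Implicit.

(** Write u f for the coefficient function x1 |-> <f, F1 x1 | a> and v g for
    x2 |-> <g, F2 x2 | b>.  On elementary tensors the coefficient function of
    F1 (x) F2 is the product of u f and v g in separate variables, so by
    Tonelli ([integral_normc_tensor]) the integral in the frame inequality is
    I1 f * I2 g, with I1 and I2 the integrals of |u f|^2 and |v g|^2, while the
    squared norm is the product of the squared norms.

    If F1 and F2 are frames, one multiplies the two pairs of inequalities.

    Conversely, fix f0 and g0 of positive norm relative to a and b.  They exist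
    because dim H1 and dim H2 are at least n, whereas a and b have n - 1 entries
    ([lin_indep_extend], [exists_n_norm_gt0]).  The lower frame bound at
    f0 (x) g0 is positive, so u f0 and v g0 are both nonzero at some point
    (z1, z2).  Freezing x2 = z2 and dividing by v g0 z2 makes every u f
    measurable, and symmetrically for v g.  Finally I1 f0 * I2 g0 lies strictly
    between 0 and +oo, which forces I2 g0 to be a positive real; dividing the
    inequalities for f (x) g0 by it bounds I1 f ([cancel_factor_bounds]), and
    symmetrically for I2.

    Both measurability steps need products of complex measurable functions to
    be measurable, which is read off from real and imaginary parts
    ([cmeasurableP]). *)

(** * Linear independence *)

Lemma lin_dep_span (K : fieldType) (V : lmodType K) (s : seq V) (x : V) :
  lin_indep s -> ~ lin_indep (x :: s) ->
  exists c : 'I_(size s) -> K, x = \sum_(i < size s) c i *: s`_i.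
Proof.
move=> hs; rewrite /lin_indep => /existsNP[c /not_implyP[]].
rewrite big_ord_recl /= => c0 /existsNP[i ci].
have [cz|cz] := eqVneq (c ord0) 0.
  move: c0; rewrite cz scale0r add0r => /(hs (fun i => c (lift ord0 i))) {}hs.
  by case: ci; case: (unliftP ord0 i) => [j|] ->.
exists (fun i => - (c ord0)^-1 * c (lift ord0 i)).
under eq_bigr do rewrite -scalerA.
rewrite -scaler_sumr scaleNr; apply/eqP; rewrite -addr_eq0.
rewrite -[X in X + _](scalerK cz) -scalerDr; apply/eqP.
by rewrite [X in _ *: X](_ : _ = 0) ?scaler0.
Qed.

(** If no x worked, [t] would lie in the span of [s], say t = C s for a matrix C
    with more rows than columns; a nonzero u with u C = 0 would then be a linear
    relation on [t]. *)
Lemma lin_indep_extend (K : fieldType) (V : lmodType K) (s t : seq V) :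
  lin_indep s -> lin_indep t -> (size s < size t)%N ->
  exists x : V, lin_indep (x :: s).
Proof.
move=> hs ht st; apply: contrapT => /forallNP dep.
have /choice[c cE] : forall i : 'I_(size t), exists c : 'I_(size s) -> K,
    t`_i = \sum_(j < size s) c j *: s`_j.
  by move=> i; exact: lin_dep_span.
pose C := \matrix_(i, j) c i j.
have kC : nz_row (kermx C) != 0.
  rewrite nz_row_eq0 kermx_eq0 /row_free neq_ltn.
  by rewrite (leq_ltn_trans (rank_leq_col _)).
have /sub_kermxP uC := nz_row_sub (kermx C).
case/negP: kC; apply/eqP/rowP => i; rewrite [RHS]mxE; move: i; apply: ht.
under eq_bigr => i _ do rewrite cE scaler_sumr.
rewrite exchange_big /= big1// => j _.
under eq_bigr => i _ do rewrite scalerA.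
move/rowP/(_ j): uC; rewrite !mxE => uC.
rewrite -scaler_suml -[RHS](scale0r s`_j) -[in RHS]uC; congr (_ *: _).
by apply: eq_bigr => i _; rewrite [C _ _]mxE.
Qed.

(** * Borel measurability of complex functions *)

Lemma normc_normC (R : rcfType) (z : R[i]) : `|z| = (Normc.normc z)%:C.
Proof. by case: z => x y; rewrite normc_def. Qed.

Lemma normc_geIm (R : rcfType) (z : R[i]) : `|complex.Im z| <= Normc.normc z.
Proof.
case: z => x y /=; rewrite -sqrtr_sqr ler_wsqrtr// lerDr; exact: sqr_ge0.
Qed.

Lemma normc_geRe (R : rcfType) (z : R[i]) : `|complex.Re z| <= Normc.normc z.
Proof.
case: z => x y /=; rewrite -sqrtr_sqr ler_wsqrtr// lerDl; exact: sqr_ge0.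
Qed.

Lemma normc_leD (R : rcfType) (z : R[i]) :
  Normc.normc z <= `|complex.Re z| + `|complex.Im z|.
Proof.
case: z => x y /=; rewrite -[leRHS]ger0_norm ?addr_ge0// -[leRHS]sqrtr_sqr.
rewrite ler_wsqrtr// sqrrD !real_normK ?num_real//.
by rewrite addrAC lerDl mulrn_wge0// mulr_ge0.
Qed.

(** The norm of [R[i]] takes values in [R[i]] itself, so the radii of balls are
    a priori complex; being positive, they are real. *)
Lemma open_complexP (R : rcfType) (U : set R[i]) :
  open (U : set (R[i] : numFieldType)) <->
  forall z, U z -> exists2 e : R, 0 < e & forall w, Normc.normc (z - w) < e -> U w.
Proof.
split=> [oU z Uz|oU].
  have /nbhs_ballP[e /= e0 eU] : nbhs (z : (R[i] : numFieldType)) U by exact: open_nbhs_nbhs.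
  case: e e0 eU => e e' ; rewrite ltcE /= => /andP[/eqP -> e0] eU.
  exists e => // w zw; apply: eU.
  rewrite -ball_normE /ball_ /= normc_normC.
  by rewrite ltcR.
rewrite openE => z /oU[e e0 eU]; apply/nbhs_ballP; exists e%:C => /=.
  by rewrite ltcR.
move=> w; rewrite -ball_normE /ball_ /= normc_normC ltcR; exact: eU.
Qed.

(** A 1-Lipschitz [p] pulls open half-lines back to open sets, and the
    half-lines generate the Borel sets of [R]. *)
Lemma lipschitz_cmeasurable (R : realType) d (X : measurableType d)
    (h : X -> R[i]) (p : R[i] -> R) :
  (forall z w, p z - p w <= Normc.normc (z - w)) ->
  cmeasurable h -> measurable_fun setT (fun x => p (h x)).
Proof.
move=> pL mh; apply: (measurability _ (RGenOInfty.measurableE R)).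
move=> _ [_ [a ->] <-].
rewrite comp_preimage; apply: mh => //.
apply: sub_sigma_algebra; apply/open_complexP => z /=.
rewrite in_itv /= andbT => az; exists (p z - a); first by rewrite subr_gt0.
move=> w zw; rewrite in_itv /= andbT.
have := le_lt_trans (pL z w) zw; lra.
Qed.

(** For the converse, every open set is the union of the rational squares that
    it contains; there are countably many of them, and the preimage of a square is
    cut out by conditions on the real and imaginary parts. *)
Lemma cmeasurableP (R : realType) d (X : measurableType d) (h : X -> R[i]) :
  cmeasurable h <->
  measurable_fun setT (fun x => complex.Re (h x)) /\ measurable_fun setT (fun x => complex.Im (h x)).
Proof.
split.
  move=> mh; split; apply: (lipschitz_cmeasurable _ mh) => z w.
  - apply: le_trans (normc_geRe (z - w)).
    by rewrite raddfB /= ler_norm.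
  - apply: le_trans (normc_geIm (z - w)).
    by rewrite raddfB /= ler_norm.
move=> [mr mi].
apply: (@measurability _ _ _ (g_sigma_algebraType _) setT _ (@open (R[i]:numFieldType))); first by [].
move=> _ [U oU <-].
pose Q (q : rat * rat * rat) : set R[i] := [set z |
  `|complex.Re z - ratr q.1.1| < ratr q.2 /\ `|complex.Im z - ratr q.1.2| < ratr q.2].
have -> : setT `&` h @^-1` U = \bigcup_q (if `[< Q q `<=` U >] then h @^-1` Q q else set0).
  rewrite setTI; apply/seteqP; split => [x Ux|x [q _]]; last first.
    by case: asboolP => // QU Qx; exact: QU.
  have /open_complexP/(_ _ Ux)[e e0 eU] := oU.
  (* Two points of a square of half-side r have real parts, and imaginary parts,
     less than 2r apart; r < e/4 keeps their distance below e. *)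
  have [r] := @rat_in_itvoo _ 0 (e/4) ltac:(lra).
  rewrite in_itv/= => /andP[r0 re].
  have near (y : R) : exists q : rat, `|y - ratr q| < ratr r.
    have yr : y - ratr r < y + ratr r by rewrite ltrBlDr -addrA ltrDl addr_gt0.
    have [q] := rat_in_itvoo yr.
    by exists q; rewrite ltr_distlC.
  have [p hp] := near (complex.Re (h x)); have [q hq] := near (complex.Im (h x)).
  exists (p, q, r) => //; case: asboolP => // -[] w [] /= hp' hq'.
  apply: eU; apply: le_lt_trans (normc_leD _) _; rewrite !raddfB /=.
  move: hp hq hp' hq' re; rewrite !ltr_distlC.
  move: (ratr p) (ratr q) (ratr r) => p' q' r'.
  move=> /andP[? ?] /andP[? ?] /andP[? ?] /andP[? ?] ?.
  by rewrite [ltRHS](splitr e) ltrD// ltr_distlC; apply/andP; split; lra.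
apply: countable_bigcupT_measurable => // q.
case: asboolP => // _.
have -> : h @^-1` Q q =
    (fun x => `|complex.Re (h x) - ratr q.1.1|) @^-1` `]-oo, ratr q.2[ `&`
    (fun x => `|complex.Im (h x) - ratr q.1.2|) @^-1` `]-oo, ratr q.2[.
  by apply/seteqP; split => x /=; rewrite !in_itv.
apply: measurableI; rewrite -[X in measurable X]setTI; apply: measurableT_comp => //.
all: exact: measurable_funB.
Qed.

Lemma cmeasurable_cst (R : realType) d (X : measurableType d) (c : R[i]) :
  cmeasurable (fun _ : X => c).
Proof. by apply/cmeasurableP; split; exact: measurable_cst. Qed.

Lemma cmeasurable_mul (R : realType) d (X : measurableType d) (h k : X -> R[i]) :
  cmeasurable h -> cmeasurable k -> cmeasurable (fun x => h x * k x).
Proof.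
move=> /cmeasurableP[hr hi] /cmeasurableP[kr ki]; apply/cmeasurableP.
have E x : h x * k x =
    (complex.Re (h x) * complex.Re (k x) - complex.Im (h x) * complex.Im (k x)) +i*
    (complex.Re (h x) * complex.Im (k x) + complex.Im (h x) * complex.Re (k x)).
  by case: (h x) (k x) => [? ?] [? ?].
split.
- under eq_fun do rewrite E /=.
  by apply: measurable_funB; exact: measurable_funM.
- under eq_fun do rewrite E /=.
  by apply: measurable_funD; exact: measurable_funM.
Qed.

Lemma cmeasurable_comp (R : realType) d d' (X : measurableType d)
    (Y : measurableType d') (h : Y -> R[i]) (p : X -> Y) :
  measurable_fun setT p -> cmeasurable h -> cmeasurable (fun x => h (p x)).
Proof. by move=> mp mh; exact: measurableT_comp mh mp. Qed.

Lemma measurable_normc_sqr (R : realType) d (X : measurableType d) (h : X -> R[i]) :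
  cmeasurable h -> measurable_fun setT (fun x => Normc.normc (h x) ^+ 2).
Proof.
move=> /cmeasurableP[hr hi].
have E x : Normc.normc (h x) ^+ 2 = complex.Re (h x) ^+ 2 + complex.Im (h x) ^+ 2.
  by case: (h x) => a b /=; rewrite sqr_sqrtr// addr_ge0// sqr_ge0.
under eq_fun do rewrite E.
by apply: measurable_funD; exact: measurable_funX.
Qed.

(** * Integrals of products in separate variables *)

Lemma integral_prodM (R : realType) d1 d2 (X1 : measurableType d1)
    (X2 : measurableType d2) (mu1 : {sigma_finite_measure set X1 -> \bar R})
    (mu2 : {sigma_finite_measure set X2 -> \bar R}) (p : X1 -> R) (q : X2 -> R) :
  measurable_fun setT p -> measurable_fun setT q ->
  (forall x, 0 <= p x) -> (forall x, 0 <= q x) ->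
  (\int[(mu1 \x mu2)%E]_x (p x.1 * q x.2)%:E =
   \int[mu1]_x (p x)%:E * \int[mu2]_x (q x)%:E)%E.
Proof.
move=> mp mq p0 q0; rewrite fubini_tonelli1/=; first last.
- by move=> x; rewrite lee_fin mulr_ge0.
- apply/measurable_EFinP; apply: measurable_funM.
    by apply: measurableT_comp => //; exact: measurable_fst.
  by apply: measurableT_comp => //; exact: measurable_snd.
rewrite -ge0_integralZr//; first last.
- by apply: integral_ge0 => x _; rewrite lee_fin.
- by move=> x _; rewrite lee_fin.
- exact/measurable_EFinP.
apply: eq_integral => x _; rewrite /fubini_F /=.
under eq_integral do rewrite EFinM.
rewrite ge0_integralZl//.
- exact/measurable_EFinP.
- by move=> y _; rewrite lee_fin.
- by rewrite lee_fin.
Qed.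

Lemma integral_normc_tensor (R : realType) d1 d2 (X1 : measurableType d1)
    (X2 : measurableType d2) (mu1 : {sigma_finite_measure set X1 -> \bar R})
    (mu2 : {sigma_finite_measure set X2 -> \bar R})
    (h : X1 -> R[i]) (k : X2 -> R[i]) : cmeasurable h -> cmeasurable k ->
  (\int[(mu1 \x mu2)%E]_x (Normc.normc (h x.1 * k x.2) ^+ 2)%:E =
   \int[mu1]_x (Normc.normc (h x) ^+ 2)%:E *
   \int[mu2]_x (Normc.normc (k x) ^+ 2)%:E)%E.
Proof.
move=> mh mk; under eq_integral do rewrite Normc.normcM exprMn.
rewrite -integral_prodM//.
- exact: (measurable_normc_sqr mh).
- exact: (measurable_normc_sqr mk).
- by move=> x; exact: sqr_ge0.
- by move=> x; exact: sqr_ge0.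
Qed.

(** * Frames *)

(** A two-sided bound on the product [I f * J] passes to [I f] because [J] is a
    positive real: the product at [f0] is positive and finite, which excludes 0
    and +oo.  The product at [f0] also shows [A <= B]. *)
Lemma cancel_factor_bounds (R : realType) (T : Type) (I : T -> \bar R)
    (N : T -> R) (J : \bar R) (c A B : R) (f0 : T) :
  (forall f, 0 <= I f)%E -> (0 <= J)%E -> 0 < c -> 0 < N f0 -> 0 < A ->
  (forall f, ((A * (N f * c) ^+ 2)%:E <= I f * J)%E /\
             (I f * J <= (B * (N f * c) ^+ 2)%:E)%E) ->
  exists A' B' : R, [/\ 0 < A', A' <= B' & forall f,
    ((A' * N f ^+ 2)%:E <= I f)%E /\ (I f <= (B' * N f ^+ 2)%:E)%E].
Proof.
move=> I0 J0 c0 Nf0 A0 AB.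
have AJ : (0 < I f0 * J)%E.
  by have [+ _] := AB f0; apply: lt_le_trans; rewrite lte_fin mulr_gt0// exprn_gt0// mulr_gt0.
have Jpos : (0 < J)%E.
  by rewrite lt0e J0 andbT; apply/eqP => Jz; move: AJ; rewrite Jz mule0 ltxx.
have Ipos : (0 < I f0)%E.
  by rewrite lt0e I0 andbT; apply/eqP => Jz; move: AJ; rewrite Jz mul0e ltxx.
case: J J0 AB AJ Jpos => [r| |] // J0 AB AJ Jpos; last first.
  by have [_] := AB f0; rewrite gt0_muley// leNgt ltry.
move: Jpos; rewrite lte_fin => r0.
have AleB : A <= B.
  have [h1 h2] := AB f0; have := le_trans h1 h2.
  by rewrite lee_fin ler_pM2r// exprn_gt0// mulr_gt0.
exists (A * c ^+ 2 / r), (B * c ^+ 2 / r); split.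
- by rewrite divr_gt0// mulr_gt0// exprn_gt0.
- by rewrite ler_pM2r ?invr_gt0// ler_pM2r// exprn_gt0.
move=> f; have [] := AB f; have := I0 f; case: (I f) => [s| |] // _; last first.
  by rewrite gt0_mulye// => _; rewrite leNgt ltry.
rewrite -EFinM !lee_fin exprMn => h1 h2; split.
  rewrite mulrAC ler_pdivrMr//; apply: le_trans h1; lra.
rewrite mulrAC ler_pdivlMr//; apply: le_trans h2 _; lra.
Qed.

(** An independent family of n vectors is longer than [a], so some f extends [a]
    to an independent family, on which the n-inner product is definite. *)
Lemma exists_n_norm_gt0 (R : realType) (n : nat) (H : lmodType R[i])
    (ip : H -> H -> n.-1.-tuple H -> R[i]) (a : n.-1.-tuple H) :
  (0 < n)%N -> n_hilbert ip -> lin_indep a -> exists f, 0 < n_norm ip f a.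
Proof.
move=> n0 [[s hs] hip _] ha.
have [|x hx] := lin_indep_extend ha hs; first by rewrite !size_tuple prednK.
exists x; rewrite sqrtr_gt0.
have nz : ip x x a <> 0 by move/(nip_eq0 hip).
have := nip_ge0 hip x a; move: nz; case: (ip x x a) => u v nz.
rewrite lecE /= => /andP[/eqP v0 u0]; rewrite lt_def u0 andbT.
by apply: contra_notN nz => /eqP ->; rewrite v0.
Qed.

Theorem theorem4p3 (R : realType) (n : nat) (hn : (2 <= n)%N)
  (H1 H2 : lmodType R[i])
  (ip1 : H1 -> H1 -> n.-1.-tuple H1 -> R[i])
  (ip2 : H2 -> H2 -> n.-1.-tuple H2 -> R[i])
  (hH1 : n_hilbert ip1) (hH2 : n_hilbert ip2)
  (a : n.-1.-tuple H1) (b : n.-1.-tuple H2)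
  (ha : lin_indep a) (hb : lin_indep b)
  (T : lmodType R[i]) (otimes : H1 -> H2 -> T) (hT : tensor_product otimes)
  (ipT : T -> T -> n.-1.-tuple T -> R[i])
  (normT : T -> n.-1.-tuple T -> R)
  (hipT : tensor_ip otimes ip1 ip2 ipT a b)
  (hnormT : tensor_norm otimes ip1 ip2 normT a b)
  (d1 d2 : measure_display)
  (X1 : measurableType d1) (X2 : measurableType d2)
  (mu1 : {sigma_finite_measure set X1 -> \bar R})
  (mu2 : {sigma_finite_measure set X2 -> \bar R})
  (F1 : X1 -> H1) (F2 : X2 -> H2) :
  tensor_continuous_frame otimes ipT normT (otimes_tuple otimes a b)
    (mu1 \x mu2)%E (fun x : X1 * X2 => otimes (F1 x.1) (F2 x.2))
  <-> continuous_frame ip1 a mu1 F1 /\ continuous_frame ip2 b mu2 F2.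
Proof.
have ipE f g : (fun x : X1 * X2 => ipT (otimes f g) (otimes (F1 x.1) (F2 x.2))
    (otimes_tuple otimes a b)) =
    (fun x => ip1 f (F1 x.1) a * ip2 g (F2 x.2) b).
  by apply/funext => x; exact: hipT.
have intE f g : (\int[(mu1 \x mu2)%E]_x (Normc.normc (ipT (otimes f g)
      (otimes (F1 x.1) (F2 x.2)) (otimes_tuple otimes a b)) ^+ 2)%:E =
    \int[(mu1 \x mu2)%E]_x
      (Normc.normc (ip1 f (F1 x.1) a * ip2 g (F2 x.2) b) ^+ 2)%:E)%E.
  by apply: eq_integral => x _; rewrite hipT.
pose I1 f := (\int[mu1]_x (Normc.normc (ip1 f (F1 x) a) ^+ 2)%:E)%E.
pose I2 g := (\int[mu2]_x (Normc.normc (ip2 g (F2 x) b) ^+ 2)%:E)%E.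
have I1_ge0 f : (0 <= I1 f)%E by apply: integral_ge0 => x _; rewrite lee_fin sqr_ge0.
have I2_ge0 g : (0 <= I2 g)%E by apply: integral_ge0 => x _; rewrite lee_fin sqr_ge0.
split; last first.
  move=> [[m1 [A1 [B1 [A1_gt0 AB1 bd1]]]] [m2 [A2 [B2 [A2_gt0 AB2 bd2]]]]].
  split.
    move=> f g; rewrite ipE; apply: cmeasurable_mul.
      exact: (cmeasurable_comp measurable_fst (m1 f)).
    exact: (cmeasurable_comp measurable_snd (m2 g)).
  have B1_gt0 := lt_le_trans A1_gt0 AB1.
  have B2_gt0 := lt_le_trans A2_gt0 AB2.
  exists (A1 * A2), (B1 * B2); split; [exact: mulr_gt0|exact: mulr_gt0|].
  move=> f g; rewrite intE hnormT (integral_normc_tensor _ _ (m1 f) (m2 g)).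
  have [l1 u1] := bd1 f; have [l2 u2] := bd2 g.
  rewrite !exprMn (mulrACA A1) (mulrACA B1) (EFinM (A1 * _)) (EFinM (B1 * _)).
  split.
    by apply: lee_pmul => //; rewrite lee_fin mulr_ge0// ?sqr_ge0// ltW.
  exact: (lee_pmul (I1_ge0 f) (I2_ge0 g) u1 u2).
move=> [mT [A [B [A_gt0 B_gt0 bd]]]].
have [f0 Nf0] : exists f, 0 < n_norm ip1 f a by apply: exists_n_norm_gt0 => //; exact: ltnW.
have [g0 Ng0] : exists g, 0 < n_norm ip2 g b by apply: exists_n_norm_gt0 => //; exact: ltnW.
(* The integral of |u f0|^2 |v g0|^2 is positive, so its integrand is not
   identically zero. *)
have [[z1 z2] nz] : exists x, ip1 f0 (F1 x.1) a * ip2 g0 (F2 x.2) b != 0.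
  apply: contrapT => /forallNP h.
  have [+ _] := bd f0 g0; rewrite intE hnormT.
  rewrite integral0_eq; last first.
    by move=> x _; move/negP: (h x); rewrite negbK => /eqP ->; rewrite Normc.normc0 expr0n.
  by rewrite leNgt lte_fin mulr_gt0// exprn_gt0// mulr_gt0.
move: nz; rewrite mulf_eq0 negb_or /= => /andP[nz1 nz2].
(* Divide the section of the tensor coefficient at z2 by its constant factor
   v g0 z2. *)
have m1 f : cmeasurable (fun x => ip1 f (F1 x) a).
  have := cmeasurable_comp (pair2_measurable z2) (mT f g0); rewrite /=.
  move=> /cmeasurable_mul/(_ (@cmeasurable_cst R _ X1 (ip2 g0 (F2 z2) b)^-1)).
  by congr cmeasurable; apply/funext => x; rewrite hipT mulfK.
have m2 g : cmeasurable (fun x => ip2 g (F2 x) b).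
  have := cmeasurable_comp (pair1_measurable z1) (mT f0 g); rewrite /=.
  move=> /cmeasurable_mul/(_ (@cmeasurable_cst R _ X2 (ip1 f0 (F1 z1) a)^-1)).
  by congr cmeasurable; apply/funext => x; rewrite hipT mulrAC mulfV// mul1r.
split; split => //.
- apply: (@cancel_factor_bounds _ _ I1 _ (I2 g0) (n_norm ip2 g0 b) A B f0) => // f.
  by have := bd f g0; rewrite intE hnormT (integral_normc_tensor _ _ (m1 f) (m2 g0)).
- apply: (@cancel_factor_bounds _ _ I2 _ (I1 f0) (n_norm ip1 f0 a) A B g0) => // g.
  have := bd f0 g; rewrite intE hnormT (integral_normc_tensor _ _ (m1 f0) (m2 g)).
  by rewrite muleC (mulrC (n_norm ip1 f0 a)).
Qed.
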